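(* Consider two Markov extraction policies $a^A,a^R$, functions of the state $(M,r,\tau)$ with values in $[0,\bar a]$, such that $a^A(x)\ge a^R(x)$ for every state $x$ ($A$ is the aggressive policy, $R$ the restrained one). Let the two controlled systems start from the same state $(M_0,r_0,\tau_0)$ and evolve under the common-randomness coupling described in the context, with states $(M_t^i,r_t^i,\tau_t^i)$ and actions $a_t^i=a^i(M_t^i,r_t^i,\tau_t^i)$, $i\in\{A,R\}$. Suppose that, almost surely, for all $t$: (1) the coupled paths remain in a region where trade probability is weakly increasing in public precision, i.e. for each $i\in\{A,R\}$ the map $\tau\mapsto D(a_t^i,r_t^i,\tau)$ is weakly increasing on $(0,\infty)$; (2) the action ordering is preserved on the coupled states: $a^A(M_t^A,r_t^A,\tau_t^A)\ge a^R(M_t^R,r_t^R,\tau_t^R)$. Then, almost surely under the coupling, at every date $t$, $$r_t^A\ge r_t^R,\qquad \tau_t^A\le\tau_t^R,\qquad N_t^A\le N_t^R,$$ where $N_t^i$ is the cumulative number of transactions of system $i$ up to date $t$. (No ordering of $M_t^A$ and $M_t^R$ is required or claimed.) Moreover, if the current state and action $(a,r,\tau)$ are held fixed, so that trade occurs in successive periods in independent trials each with probability $D(a,r,\tau)$, then the expected waiting time for the next outcome signal is $1/D(a,r,\tau)$. This waiting time is weakly longer on the aggressive path: almost surely, for all $t$, $$\frac1{D(a_t^A,r_t^A,\tau_t^A)}\ge \frac1{D(a_t^R,r_t^R,\tau_t^R)}.$$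
   Context: Parameters: $\kappa>0$, $\tau_z>0$, $\ell>0$, $\underline u>0$, $\chi\ge 0$, $0\le\rho<1$, $\gamma>0$, $\bar r>0$, $\bar a>0$; initial state $M_0\in\mathbb R$, $r_0\in[0,\bar r]$, $\tau_0>0$. The trade probability is $$D(a,r,\tau)=\Phi\!\left(\frac{h(a,r)}{\omega(\tau)}\right),\quad h(a,r)=\ell-\underline u-a-\chi r,\quad \omega(\tau)=\frac{\sqrt{2\kappa}}{\tau+\kappa},$$ with $\Phi$ the standard normal cdf. $M$ is the public margin, $r$ the trust distance, $\tau$ the public precision. Coupled dynamics: in each period $t$ draw $U_t\sim\mathrm{Uniform}[0,1]$ and $Z_t\sim N(0,1)$, all independent across $t$ and of each other. System $i\in\{A,R\}$ trades in period $t$ iff $U_t\le D(a_t^i,r_t^i,\tau_t^i)$ (same $U_t$ for both systems). In either case $r_{t+1}^i=\min\{\bar r,\rho r_t^i+\gamma a_t^i\}$. If system $i$ trades, an outcome signal is produced, $\tau_{t+1}^i=\tau_t^i+\tau_z$, and $M_{t+1}^i=M_t^i+\sqrt{\tau_z/[\tau_t^i(\tau_t^i+\tau_z)]}\;Z_t$ (same draw $Z_t$ for both systems when both trade). If system $i$ does not trade, $\tau_{t+1}^i=\tau_t^i$ and $M_{t+1}^i=M_t^i$. *)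

(* Defs.v *)
From HB Require Import structures.
From mathcomp Require Import all_boot all_order all_algebra.
From mathcomp Require Import all_classical all_reals all_analysis.

Set Implicit Arguments.
Unset Strict Implicit.
Unset Printing Implicit Defensive.

Import Order.TTheory GRing.Theory Num.Theory.
Import numFieldNormedType.Exports.

Local Open Scope classical_set_scope.
Local Open Scope ring_scope.

Section Model.
Context {R : realType}.

Record primitives := Primitives {
  kappa : R; tau_z : R; ell : R; ubar : R; chi : R; rho : R; gam : R;
  rbar : R; abar : R }.

Definition valid_primitives (p : primitives) : Prop :=
  [/\ 0 < kappa p, 0 < tau_z p, 0 < ell p & 0 < ubar p] /\
  [/\ 0 <= chi p, 0 <= rho p < 1, 0 < gam p, 0 < rbar p & 0 < abar p].

Definition Phi (x : R) : R := fine (normal_prob 0 1 `]-oo, x]).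

Definition surplus (p : primitives) (a r : R) : R :=
  ell p - ubar p - a - chi p * r.

Definition omega (p : primitives) (tau : R) : R :=
  Num.sqrt (2 * kappa p) / (tau + kappa p).

Definition D (p : primitives) (a r tau : R) : R :=
  Phi (surplus p a r / omega p tau).

Record state := State { margin : R; trust : R; precision : R }.

(* The state space of the model; policies are total functions on [state], but
   their values matter only here. *)
Definition admissible (p : primitives) (x : state) : Prop :=
  0 <= trust x <= rbar p /\ 0 < precision x.

Definition D_at (p : primitives) (pol : state -> R) (x : state) : R :=
  D p (pol x) (trust x) (precision x).

Definition trades (p : primitives) (pol : state -> R) (x : state) (u : R) :
    bool :=
  u <= D_at p pol x.

Definition step (p : primitives) (pol : state -> R) (x : state) (u z : R) :
    state :=
  let r' := Num.min (rbar p) (rho p * trust x + gam p * pol x) in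
  let tau := precision x in
  if trades p pol x u then
    State (margin x + Num.sqrt (tau_z p / (tau * (tau + tau_z p))) * z)
          r' (tau + tau_z p)
  else State (margin x) r' tau.

(* State at date t, given realized sequences u, z of the common draws. *)
Fixpoint state_at (p : primitives) (pol : state -> R) (x0 : state)
    (u z : nat -> R) (t : nat) : state :=
  if t is s.+1 then step p pol (state_at p pol x0 u z s) (u s) (z s) else x0.

(* Trades in periods 0, ..., t, period t included. *)
Definition transactions (p : primitives) (pol : state -> R) (x0 : state)
    (u z : nat -> R) (t : nat) : nat :=
  (\sum_(s < t.+1) trades p pol (state_at p pol x0 u z s) (u s))%N.

End Model.
Arguments primitives : clear implicits.
Arguments state : clear implicits.

Section Probability.
Context d (T : measurableType d) (R : realType) (P : probability T R).

(* Stated on measurable sets only: elsewhere both sides are junk values. *)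
Definition has_law (X : {RV P >-> R}) (mu : set R -> \bar R) : Prop :=
  forall B : set R, measurable B -> distribution P X B = mu B.

(* Product rule over every finite subfamily. *)
Definition independent_events (I : eqType) (E : I -> set T) : Prop :=
  forall s : seq I, uniq s ->
    P (\bigcap_(i in [set` s]) E i) = (\prod_(i <- s) P (E i))%E.

Definition independent_RVs (I : eqType) (X : I -> {RV P >-> R}) : Prop :=
  forall B : I -> set R, (forall i, measurable (B i)) ->
    independent_events (fun i => X i @^-1` B i).

(* Trial k succeeds on E k. *)
Definition independent_trials (E : nat -> set T) (q : R) : Prop :=
  [/\ forall k, measurable (E k), forall k, P (E k) = q%:E
    & independent_events E].

(* Number of trials up to and including the first success; the infimum of the
   empty set makes it +oo when no trial succeeds. *)
Definition waiting_time (E : nat -> set T) (w : T) : \bar R :=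
  ereal_inf [set (k.+1%:R)%:E | k in [set k | E k w]].

End Probability.
Arguments waiting_time {d T R} E w.

(* Main.v *)
Require Import Defs.
From HB Require Import structures.
From mathcomp Require Import all_boot all_order all_algebra.
From mathcomp Require Import all_classical all_reals all_analysis.
From mathcomp Require Import measurable_realfun ring lra.

Set Implicit Arguments.
Unset Strict Implicit.
Unset Printing Implicit Defensive.

Import Order.TTheory GRing.Theory Num.Theory.
Import numFieldNormedType.Exports.

Local Open Scope classical_set_scope.
Local Open Scope ring_scope.

(* A higher action and a larger trust distance both lower the trade surplus,
   and a lower precision lowers the trade probability by hypothesis (1). So as
   long as the restrained system has the smaller trust distance and the larger
   precision, its trade probability is the larger one; under the common [U_t]
   every trade of the aggressive system is then matched by one of the restrained
   system, and the two orderings propagate to the next date. *)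

(** * Bounds, monotonicity and positivity of the normal cdf *)

Section StandardNormal.
Context {R : realType}.
Implicit Types x y : R.

Lemma normal_cdfE x : (Phi x)%:E = normal_prob 0 1 `]-oo, x].
Proof. by rewrite fineK// fin_num_measure. Qed.

Lemma normal_cdf_le1 x : Phi x <= 1.
Proof. by rewrite -lee_fin normal_cdfE probability_le1. Qed.

Lemma normal_cdf_nondecreasing x y : x <= y -> Phi x <= Phi y.
Proof.
move=> xy; rewrite -lee_fin !normal_cdfE; apply: le_measure; rewrite ?inE//.
by apply: subset_itvl; rewrite bnd_simp.
Qed.

(** The density is bounded below by a positive constant on the unit interval ending at [x], so that
    interval alone carries positive mass. This keeps [1 / D] a genuine reciprocal. *)
Lemma normal_cdf_gt0 x : 0 < Phi x.
Proof.
(* [c] is the density at [|x| + 1], and no point of [[x - 1, x]] lies farther than that from the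
   mean. *)
pose c : R := normal_peak 1 * expR (- (`|x| + 1) ^+ 2 / (1 ^+ 2 *+ 2)).
have c_gt0 : 0 < c by rewrite mulr_gt0 ?expR_gt0// normal_peak_gt0.
have pdf_ge0 y : (0 <= (normal_pdf 0 1 y)%:E)%E.
  by rewrite lee_fin normal_pdf_ge0.
rewrite -lte_fin normal_cdfE /normal_prob.
apply: (@lt_le_trans _ _
    (\int[lebesgue_measure]_(y in `[(x - 1)%R, x]) (normal_pdf 0 1 y)%:E)%E); last first.
  apply: ge0_subset_integral => //; last by apply: subset_itvr; rewrite bnd_simp.
  by apply/measurable_EFinP/measurable_funTS; exact: measurable_normal_pdf.
apply: (@lt_le_trans _ _
    (\int[lebesgue_measure]_(y in `[(x - 1)%R, x]) (cst c%:E) y)%E).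
  rewrite integral_cst//= lebesgue_measure_itv/= lte_fin gtrBl ltr01.
  by rewrite -EFinD opprB addrC subrK mule1 lte_fin.
apply: ge0_le_integral => //.
- by move=> y _; rewrite lee_fin ltW.
- by apply/measurable_EFinP/measurable_funTS; exact: measurable_normal_pdf.
move=> y /=; rewrite in_itv/= => /andP[xy yx].
rewrite lee_fin normal_pdfE ?oner_neq0// ler_wpM2l ?normal_peak_ge0//.
rewrite /normal_fun subr0 ler_expR !mulNr lerN2 ler_wpM2r ?invr_ge0//.
have y_le : `|y| <= `|x| + 1.
  by rewrite ler_norml; apply/andP; split; have := ler_norm x;
    have := ler_norm (- x); rewrite normrN; lra.
by rewrite -[y ^+ 2]real_normK ?num_real// ler_sqr ?nnegrE ?addr_ge0.
Qed.

End StandardNormal.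

(** Turns the law of the draws into a success probability: a uniform draw falls below a threshold
    [q] in the unit interval with probability exactly [q]. *)
Lemma uniform_cdf (R : realType) (q : R) : 0 <= q <= 1 ->
  uniform_prob (@ltr01 R) `]-oo, q] = q%:E.
Proof.
move=> /andP[q0 q1]; rewrite /uniform_prob integral_uniform_pdf.
have -> : `]-oo, q] `&` `[0, 1] = `[0, q]%classic :> set R.
  apply/seteqP; split=> y /=; rewrite !in_itv/=.
    by move=> [-> /andP[-> _]].
  by move=> /andP[-> yq]; rewrite yq (le_trans yq q1).
rewrite (eq_integral (cst 1%E)); last first.
  move=> y; rewrite inE/= in_itv/= => /andP[y0 yq].
  by rewrite /uniform_pdf y0 (le_trans yq q1) subr0 invr1.
rewrite integral_cst//= mul1e lebesgue_measure_itv/= lte_fin.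
by case: ltP => [_|q_le0]; [rewrite oppr0 adde0|rewrite (le_anti (introT andP (conj q_le0 q0)))].
Qed.

(** * Expectation of the geometric waiting time *)

Section WaitingTime.
Context d (T : measurableType d) (R : realType) (P : probability T R).

Definition first_failures (E : nat -> set T) (n : nat) : set T :=
  \bigcap_(k in `I_n) ~` E k.

Lemma measurable_first_failures (E : nat -> set T) n :
  (forall k, measurable (E k)) -> measurable (first_failures E n).
Proof.
move=> mE; rewrite /first_failures bigcap_mkord.
by apply: bigsetI_measurable => k _; apply: measurableC.
Qed.

(* The later successes carried along make the induction on [n] go through. *)
Lemma prob_first_failures_successes (E : nat -> set T) (q : R) n (s : seq nat) :
  independent_trials P E q -> uniq s -> all (leq n) s ->
  P (first_failures E n `&` \bigcap_(i in [set` s]) E i) =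
    ((1 - q) ^+ n * q ^+ size s)%:E.
Proof.
move=> [mE PE indE].
have mEs (r : seq nat) : measurable (\bigcap_(i in [set` r]) E i).
  by rewrite bigcap_seq; apply: bigsetI_measurable.
elim: n s => [|n IHn] s us sn.
  rewrite /first_failures II0 bigcap_set0 setTI indE// expr0 mul1r.
  elim: s {us sn} => [|i s IHs] /=; first by rewrite big_nil expr0.
  by rewrite big_cons IHs PE -EFinM exprS.
(* Failure of trial [n] is removal of [E n], so the probability becomes a difference whose
   subtracted term is the induction hypothesis with [n] added to the successes. *)
have -> : first_failures E n.+1 `&` \bigcap_(i in [set` s]) E i =
    (first_failures E n `&` \bigcap_(i in [set` s]) E i) `\` E n.
  by rewrite /first_failures IIS bigcap_setU bigcap_set1 setDE setIAC.
rewrite measureD//; last 2 first.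
- by apply: measurableI => //; exact: measurable_first_failures.
- by rewrite ltey_eq fin_num_measure//; apply: measurableI => //;
    exact: measurable_first_failures.
have -> : first_failures E n `&` \bigcap_(i in [set` s]) E i `&` E n =
    first_failures E n `&` \bigcap_(i in [set` n :: s]) E i.
  by rewrite -setIA !bigcap_seq big_cons [E n `&` _]setIC.
have uns : uniq (n :: s).
  by rewrite /= us andbT; apply/negP => /(allP sn); rewrite ltnn.
have ns : all (leq n) s by apply: sub_all sn => k /ltnW.
have nns : all (leq n) (n :: s) by rewrite /= leqnn.
transitivity (((1 - q) ^+ n * q ^+ size s)%:E -
    ((1 - q) ^+ n * q ^+ size (n :: s))%:E)%E.
  by congr (_ - _)%E; exact: IHn.
by rewrite -EFinB /= !exprS; congr (_%:E); ring.
Qed.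

Lemma prob_first_failures (E : nat -> set T) (q : R) n :
  independent_trials P E q -> P (first_failures E n) = ((1 - q) ^+ n)%:E.
Proof.
move=> trials.
have := prob_first_failures_successes (n := n) (s := [::]) trials erefl erefl.
by rewrite bigcap_seq big_nil setIT mulr1.
Qed.

(** Count the [n] whose first [n] trials all fail. With first success at index [k] these are
    [0, ..., k], that is [k.+1] of them; with no success every [n] counts and both sides are
    [+oo]. *)
Lemma waiting_time_series (E : nat -> set T) w :
  waiting_time E w = (\sum_(n <oo) (\1_(first_failures E n) w)%:E)%E :> \bar R.
Proof.
have ind_ge0 n : (0 <= (\1_(first_failures E n) w)%:E :> \bar R)%E.
  by rewrite lee_fin.
have [[m Em]|noE] := pselect (exists k, E k w); last first.
  rewrite /waiting_time (_ : [set k | E k w] = set0); last first.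
    by rewrite -subset0 => k Ek; apply: noE; exists k.
  rewrite image_set0 ereal_inf0; apply/esym/cvg_lim => //.
  rewrite (_ : (fun n => _) = (fun n => n%:R%:E)); last first.
    apply/funext => n; rewrite (eq_bigr (fun=> 1%E)) => [|k _]; last first.
      by rewrite indicE mem_set// => j _ Ej; apply: noE; exists j.
    by rewrite sumEFin big_const_nat subn0 iter_addr_0.
  exact/cvgenyP.
have exE : exists k, `[< E k w >] by exists m; apply/asboolP.
case: (ex_minnP exE) => k /asboolP Ek k_min {m Em exE}.
have indE n : \1_(first_failures E n) w = (n <= k)%:R :> R.
  rewrite indicE; case: leqP => [nk|kn].
    rewrite mem_set// => j /= jn Ej.
    by have := leq_trans jn nk; rewrite ltnNge k_min//; apply/asboolP.
  by rewrite memNset// => /(_ k kn).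
rewrite (nneseries_split _ k.+1)// add0n [X in (_ + X)%E]eseries0 ?adde0; last first.
  by move=> n kn _; rewrite indE leqNgt kn.
rewrite (eq_big_nat _ _ (F2 := fun=> 1%E)) => [|n /andP[_ nk]]; last first.
  by rewrite indE -ltnS nk.
rewrite sumEFin big_const_nat subn0 iter_addr_0.
apply/eqP; rewrite eq_le; apply/andP; split.
  by apply: ereal_inf_lbound; exists k.
apply: le_ereal_inf_tmp => _ [j /= Ej <-]; rewrite lee_fin ler_nat ltnS.
by apply: k_min; apply/asboolP.
Qed.

(* Tail-sum formula: the waiting time exceeds [n] exactly when the first [n]
   trials fail, so its expectation is the geometric series of ratio [1 - q]. *)
Lemma expected_waiting_time (E : nat -> set T) (q : R) : 0 < q ->
  independent_trials P E q -> (\int[P]_w waiting_time E w = (1 / q)%:E)%E.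
Proof.
move=> q_gt0 trials; have [mE PE _] := trials.
(* As the probability of trial 0, [q] is at most 1, so the ratio [1 - q] lies in [[0, 1)]. *)
have q_le1 : q <= 1 by rewrite -lee_fin -(PE 0%N) probability_le1.
have mF n : measurable (first_failures E n) by exact: measurable_first_failures.
under eq_integral do rewrite waiting_time_series.
(* Nonnegative terms allow exchanging sum and integral. *)
rewrite integral_nneseries//; last first.
  by move=> n; apply/measurable_EFinP; exact: measurable_indic.
rewrite (eq_eseriesr (g := fun n => (geometric 1 (1 - q) n)%:E)); last first.
  move=> n _; rewrite integral_indic// setIT /= mul1r.
  exact: prob_first_failures.
under eq_fun do rewrite sumEFin.
have geo := @cvg_geometric_series R 1 (1 - q).
apply/cvg_lim => //; apply: cvg_EFin; first exact: nearW.
have -> : 1 / q = 1 * (1 - (1 - q))^-1 by rewrite opprB addrC subrK.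
by apply: geo; rewrite ger0_norm ?subr_ge0// gtrBl.
Qed.

End WaitingTime.

(** With the threshold frozen, the successes are preimages of one half-line under the draws from
    date [t] on, so they inherit independence from the joint family. *)
Lemma uniform_trials (d : measure_display) (T : measurableType d)
    (R : realType) (P : probability T R) (U Z : nat -> {RV P >-> R}) (q : R) t :
  0 <= q <= 1 ->
  (forall t, has_law (U t) (uniform_prob (@ltr01 R))) ->
  independent_RVs
    (fun i : nat + nat => match i with inl t => U t | inr t => Z t end) ->
  independent_trials P (fun k => [set w | U (t + k)%N w <= q]) q.
Proof.
move=> q01 lawU indUZ.
have EE k : [set w | U k w <= q] = U k @^-1` `]-oo, q].
  by apply/seteqP; split=> w /=; rewrite in_itv.
split=> [k|k|s us].
- by rewrite EE; exact: measurable_funPTI.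
- rewrite EE -(uniform_cdf q01) -(lawU (t + k)%N)//.
(* The half-line is assigned to every index, but the finite subfamily selects only the indices
   [inl (t + k)]; injectivity of the shift keeps them distinct. *)
- have := indUZ (fun=> `]-oo, q]%classic) (fun=> measurable_itv _)
    [seq inl (t + k)%N | k <- s].
  rewrite map_inj_uniq => [/(_ us)|j k [/addnI]//].
  rewrite big_map => indU.
  under eq_bigr do rewrite EE; rewrite -indU; congr (P _).
  apply/seteqP; split=> w /= Ew.
    by move=> _ /= /mapP[k ks ->] /=; rewrite in_itv/=; exact: Ew.
  move=> k /= ks; have := Ew (inl (t + k)%N).
  by rewrite /= in_itv/=; apply; apply: map_f.
Qed.

(** * Pathwise comparison of the two coupled systems *)

Section Coupling.
Context {R : realType}.
Variable p : primitives R.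
Hypothesis p_valid : valid_primitives p.

Lemma omega_gt0 tau : 0 < tau -> 0 < omega p tau.
Proof.
move: p_valid => -[[kappa0 _ _ _] _] tau0.
by rewrite /omega divr_gt0 ?addr_gt0// sqrtr_gt0 mulr_gt0.
Qed.

Lemma trade_probability_gt0 a r tau : 0 < D p a r tau.
Proof. exact: normal_cdf_gt0. Qed.

Lemma trade_probability_antitone a a' r r' tau : 0 < tau -> a <= a' -> r <= r' ->
  D p a' r' tau <= D p a r tau.
Proof.
move: p_valid => -[_ [chi0 _ _ _ _]] tau0 aa' rr'.
apply: normal_cdf_nondecreasing.
rewrite ler_wpM2r ?invr_ge0 ?(ltW (omega_gt0 _))// /surplus lerB//; last exact: ler_wpM2l.
exact: lerB.
Qed.

Lemma precision_state_at_gt0 pol x0 u z t : 0 < precision x0 ->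
  0 < precision (state_at p pol x0 u z t).
Proof.
move: p_valid => -[[_ tau_z0 _ _] _] x0_gt0.
by elim: t => //= t IHt; rewrite /step; case: ifP => //= _; rewrite addr_gt0.
Qed.

Variables (aA aR : state R -> R) (x0 : state R) (u z : nat -> R).
Let xA := state_at p aA x0 u z.
Let xR := state_at p aR x0 u z.
Hypothesis x0_gt0 : 0 < precision x0.
Hypothesis D_monotone : forall t tau tau', 0 < tau -> tau <= tau' ->
  D p (aR (xR t)) (trust (xR t)) tau <= D p (aR (xR t)) (trust (xR t)) tau'.
Hypothesis action_le : forall t, aR (xR t) <= aA (xA t).

Lemma trade_probability_order t :
  trust (xR t) <= trust (xA t) -> precision (xA t) <= precision (xR t) ->
  D_at p aA (xA t) <= D_at p aR (xR t).
Proof.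
have tauA0 : 0 < precision (xA t) by exact: precision_state_at_gt0.
(* The intermediate value is the trade probability of the restrained action and trust at the
   aggressive precision. *)
move=> r_le tau_le; rewrite /D_at; apply: (le_trans _ (D_monotone t tauA0 tau_le)).
exact: trade_probability_antitone.
Qed.

(** The two orderings go through one induction: ordering the next precisions requires ordered trade
    probabilities, which rest on both current orderings. *)
Lemma state_order t :
  trust (xR t) <= trust (xA t) /\ precision (xA t) <= precision (xR t).
Proof.
move: p_valid => -[[_ tau_z0 _ _] [_ /andP[rho0 _] gam0 _ _]].
elim: t => [//|t [r_le tau_le]]; split.
  (* Trust evolves the same way with or without trade, so its ordering needs no case split. *)
  have r_next pol x v y :
      trust (step p pol x v y) = Num.min (rbar p) (rho p * trust x + gam p * pol x).
    by rewrite /step; case: ifP.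
  rewrite /xA /xR /= !r_next le_min2//.
  by apply: lerD; rewrite ler_wpM2l// ltW.
have := trade_probability_order r_le tau_le.
rewrite /xA /xR /= /step /trades -/xA -/xR => D_le.
(* If the aggressive system trades, so does the other, and both gain [tau_z]. Otherwise its
   precision is unchanged while the other can only grow. *)
have [/le_trans/(_ D_le) ->|_] := leP (u t) (D_at p aA _); first by rewrite /= lerD2r.
by case: ifP => //= _; rewrite (le_trans tau_le)// lerDl ltW.
Qed.

Lemma D_at_order t : D_at p aA (xA t) <= D_at p aR (xR t).
Proof. by have [? ?] := state_order t; exact: trade_probability_order. Qed.

Lemma transactions_order t :
  (transactions p aA x0 u z t <= transactions p aR x0 u z t)%N.
Proof.
apply: leq_sum => s _; rewrite /trades.
by case: leP => // /le_trans/(_ (D_at_order s)) ->.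
Qed.

Lemma waiting_time_order t :
  1 / D_at p aR (xR t) <= 1 / D_at p aA (xA t).
Proof.
by rewrite !div1r lef_pV2 ?posrE ?trade_probability_gt0//; exact: D_at_order.
Qed.

End Coupling.

Theorem proposition3 (R : realType) (p : primitives R)
    (d : measure_display) (T : measurableType d) (P : probability T R)
    (U Z : nat -> {RV P >-> R}) (aA aR : state R -> R) (x0 : state R) :
  let xA (t : nat) (w : T) := state_at p aA x0 (U^~ w) (Z^~ w) t in
  let xR (t : nat) (w : T) := state_at p aR x0 (U^~ w) (Z^~ w) t in
  let NA (t : nat) (w : T) := transactions p aA x0 (U^~ w) (Z^~ w) t in
  let NR (t : nat) (w : T) := transactions p aR x0 (U^~ w) (Z^~ w) t in
  valid_primitives p ->
  admissible p x0 ->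
  (forall t, has_law (U t) (uniform_prob (@ltr01 R))) ->
  (forall t, has_law (Z t) (normal_prob 0 1)) ->
  independent_RVs
    (fun i : nat + nat => match i with inl t => U t | inr t => Z t end) ->
  (forall x, admissible p x -> 0 <= aA x <= abar p) ->
  (forall x, admissible p x -> 0 <= aR x <= abar p) ->
  (forall x, admissible p x -> aR x <= aA x) ->
  {ae P, forall w, forall (t : nat) (tau tau' : R), 0 < tau -> tau <= tau' ->
     D p (aA (xA t w)) (trust (xA t w)) tau
       <= D p (aA (xA t w)) (trust (xA t w)) tau' /\
     D p (aR (xR t w)) (trust (xR t w)) tau
       <= D p (aR (xR t w)) (trust (xR t w)) tau'} ->
  {ae P, forall w, forall t : nat, aR (xR t w) <= aA (xA t w)} ->
  [/\ {ae P, forall w, forall t : nat,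
         [/\ trust (xR t w) <= trust (xA t w),
             precision (xA t w) <= precision (xR t w)
           & (NA t w <= NR t w)%N]},
      forall a r tau : R, 0 <= a <= abar p -> 0 <= r <= rbar p -> 0 < tau ->
        (forall t : nat, independent_trials P
           (fun k => [set w | U (t + k)%N w <= D p a r tau]) (D p a r tau)) /\
        (forall E : nat -> set T, independent_trials P E (D p a r tau) ->
           (\int[P]_w waiting_time E w)%E = (1 / D p a r tau)%:E)
    & {ae P, forall w, forall t : nat,
         1 / D_at p aR (xR t w) <= 1 / D_at p aA (xA t w)}].
Proof.
move=> xA xR NA NR p_valid [_ x0_gt0] lawU _ indUZ _ _ _ ae_mono ae_act.
split.
(* Both almost sure hypotheses hold jointly off a null set, where the deterministic comparison
   applies to each path. *)
- apply: filterS2 ae_mono ae_act => w mono act t.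
  have D_mono s tau tau' (tau0 : 0 < tau) (le_tau : tau <= tau') :=
    (mono s tau tau' tau0 le_tau).2.
  have [r_le tau_le] := state_order p_valid x0_gt0 D_mono act t.
  by split=> //; exact: transactions_order.
- move=> a r tau _ _ _; split=> [t|E].
    apply: (uniform_trials _ _ lawU indUZ).
    by rewrite normal_cdf_le1 ltW// trade_probability_gt0.
  exact/expected_waiting_time/trade_probability_gt0.
- apply: filterS2 ae_mono ae_act => w mono act t.
  apply: waiting_time_order => // s tau tau' tau0 le_tau.
  exact: (mono s tau tau' tau0 le_tau).2.
Qed.
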